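(* Let $K$ and $L$ be finite simplicial complexes and let $\sigma_1,\sigma_2$ be a pair of distinct, adjacent $k$-dimensional simplices in $K$. Let $\alpha_i:\sigma_i\to K$ be the embedding of $\sigma_i$ in $K$ and $\widehat{\alpha}_i:Hom(K,L)\to Hom(\sigma_i,L)$ the associated map of $Hom$-complexes, $i=1,2$. Then the diagram \[ \begin{array}{ccc} Hom(K,L) & \stackrel{=}{\longrightarrow} & Hom(K,L)\\ {\scriptstyle\widehat{\alpha}_{1}}\downarrow & & \downarrow{\scriptstyle\widehat{\alpha}_{2}}\\ Hom(\sigma_1,L) & \stackrel{\mathcal{P}^L(\overrightarrow{\sigma_1\sigma_2})}{\longleftarrow} & Hom(\sigma_2,L) \end{array} \] commutes up to homotopy, i.e. $\mathcal{P}^L(\overrightarrow{\sigma_1\sigma_2})\circ\widehat{\alpha}_2\simeq\widehat{\alpha}_1$.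
   Context: Two $k$-dimensional simplices are adjacent if they share a common $(k-1)$-dimensional face. Simplices are regarded as simplicial complexes together with all their faces. $V(K)$ is the vertex set of $K$ and $\Delta^S$ is the simplex with vertex set $S$. For finite simplicial complexes $K,L$, the cell complex $Hom(K,L)\subset\prod_{v\in V(K)}\Delta^{V(L)}$ is the union of the cells $c_\eta=\prod_{v\in V(K)}\Delta^{\eta(v)}$ indexed by functions $\eta:V(K)\to 2^{V(L)}\setminus\{\emptyset\}$ such that (1) $\eta(u)\cap\eta(v)=\emptyset$ whenever $u\ne v$ and $\{u,v\}\in K$; (2) for each simplex $\sigma\in K$, the join $\ast_{v\in V(\sigma)}\eta(v)$ of the $0$-dimensional complexes $\eta(v)$ is a subcomplex of $L$, i.e. every set obtained by choosing one element from each $\eta(v)$, $v\in V(\sigma)$, is a simplex of $L$. A non-degenerate (injective on simplices) simplicial map $f:K\to K'$ induces the continuous map $\widehat f:Hom(K',L)\to Hom(K,L)$, $(p_w)_{w\in V(K')}\mapsto(p_{f(v)})_{v\in V(K)}$, which on cells is $\eta\mapsto\eta\circ f$. The perspectivity (flip) $\overrightarrow{\sigma_1\sigma_2}:\sigma_1\to\sigma_2$ is the simplicial isomorphism which fixes the common $(k-1)$-face pointwise and sends the remaining vertex of $\sigma_1$ to the remaining vertex of $\sigma_2$. The parallel transport $\mathcal{P}^L(\overrightarrow{\sigma_1\sigma_2}):Hom(\sigma_2,L)\to Hom(\sigma_1,L)$ is the map induced by $\overrightarrow{\sigma_1\sigma_2}$, i.e. $\eta\mapsto\eta\circ\overrightarrow{\sigma_1\sigma_2}$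 on cells. *)

(* Defs.v *)
From HB Require Import structures.
From mathcomp Require Import all_boot all_order all_algebra.
From mathcomp Require Import all_classical reals topology normedtype.

Set Implicit Arguments.
Unset Strict Implicit.
Unset Printing Implicit Defensive.

Import Order.TTheory GRing.Theory Num.Theory.
Import numFieldNormedType.Exports.

Local Open Scope classical_set_scope.
Local Open Scope ring_scope.

(* The vertex set of a complex is its whole carrier type. The empty simplex is
   not listed among the simplices. *)
Record complex (V : finType) := Complex {
  simplices :> {set {set V}};
  simplex_gt0 : forall s, s \in simplices -> (0 < #|s|)%N;
  simplex_face : forall s t : {set V}, s \in simplices -> t \subset s ->
    (0 < #|t|)%N -> t \in simplices;
  simplex_vertex : forall v, [set v]%SET \in simplices }.

Section FullSimplex.
Variable V : finType.

Definition nonempty_sets : {set {set V}} :=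
  [set t : {set V} | (0 < #|t|)%N]%SET.

Fact nonempty_sets_gt0 s : s \in nonempty_sets -> (0 < #|s|)%N.
Proof. by rewrite finset.inE. Qed.

Fact nonempty_sets_face (s t : {set V}) : s \in nonempty_sets -> t \subset s ->
  (0 < #|t|)%N -> t \in nonempty_sets.
Proof. by rewrite !finset.inE. Qed.

Fact nonempty_sets_vertex v : [set v]%SET \in nonempty_sets.
Proof. by rewrite finset.inE cards1. Qed.

Definition full_simplex : complex V :=
  Complex nonempty_sets_gt0 nonempty_sets_face nonempty_sets_vertex.

End FullSimplex.

(* A simplex s of a complex on V, regarded as a complex with all its faces:
   its vertices form the subtype {v | v \in s}. *)
Definition face_complex (V : finType) (s : {set V}) : complex {v | v \in s} :=
  full_simplex {v | v \in s}.

Record nondeg_map (V V' : finType) (K : complex V) (K' : complex V') := NondegMap {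
  nondeg_fun :> V -> V';
  nondeg_simplex : forall s, s \in K -> nondeg_fun @: s \in K';
  nondeg_inj : forall s, s \in K -> {in s &, injective nondeg_fun} }.

Section HomComplex.
Variable R : realType.

(* The geometric simplex with vertex set S, in barycentric coordinates. *)
Definition Delta (W : finType) (S : {set W}) : set {ptws W -> R} :=
  [set x | [/\ forall w, 0 <= x w, \sum_w x w = 1 &
               forall w, w \notin S -> x w = 0]].

Definition multihom (V W : finType) (K : complex V) (L : complex W)
    (eta : V -> {set W}) : Prop :=
  [/\ forall v, (0 < #|eta v|)%N,
      forall u v, u != v -> [set u; v]%SET \in K ->
        eta u :&: eta v = finset.set0 &
      forall s, s \in K -> forall c : V -> W,
        (forall v, v \in s -> c v \in eta v) -> c @: s \in L].

Definition cell (V W : finType) (eta : V -> {set W}) :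
    set {ptws V -> {ptws W -> R}} :=
  [set p | forall v, Delta (eta v) (p v)].

(* Used as a type, Hom K L carries the subspace topology. *)
Definition Hom (V W : finType) (K : complex V) (L : complex W) :
    set {ptws V -> {ptws W -> R}} :=
  \bigcup_(eta in multihom K L) cell eta.

Section HomMap.
Variables (V V' W : finType) (K : complex V) (K' : complex V').
Variables (L : complex W) (f : nondeg_map K K').

Lemma multihom_comp eta : multihom K' L eta -> multihom K L (eta \o f).
Proof.
case=> e0 edis echo; split=> [v | u v uv uvK | s sK c cs] /=; first exact: e0.
- apply: edis; last by rewrite -!imset_set1 -imsetU; exact: nondeg_simplex.
  apply: contra uv => /eqP fuv; apply/eqP.
  by apply: (nondeg_inj uvK) fuv; rewrite !finset.inE eqxx ?orbT.
- have [v0 v0s] : exists v0, v0 \in s by apply/card_gt0P/(simplex_gt0 sK).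
  pose g w := odflt v0 [pick v in s | f v == w].
  have gf v : v \in s -> g (f v) = v.
    rewrite /g => vs; case: pickP => [u /andP[us /eqP fuv]|/(_ v)] /=.
      exact: (nondeg_inj sK) fuv.
    by rewrite vs eqxx.
  have <- : (c \o g) @: (f @: s) = c @: s.
    by rewrite -imset_comp; apply: eq_in_imset => v vs /=; rewrite gf.
  apply: echo; first exact: nondeg_simplex.
  by move=> _ /imsetP[v vs ->] /=; rewrite gf // cs.
Qed.

Lemma cell_comp (eta : V' -> {set W}) (p : {ptws V' -> {ptws W -> R}}) :
  cell eta p -> cell (eta \o f) (p \o f).
Proof. by move=> ep v; exact: ep. Qed.

Lemma Hom_comp p : Hom K' L p -> Hom K L (p \o f).
Proof.
by case=> eta he ep; exists (eta \o f); [exact: multihom_comp|exact: cell_comp].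
Qed.

Definition Hom_map (p : Hom K' L) : Hom K L :=
  SigSub (mem_set (Hom_comp (set_mem (valP p)))).

Lemma Hom_map_continuous : continuous Hom_map.
Proof.
apply/continuousP => _ [B oB <-].
have cval (v : V') : continuous (fun p : Hom K' L => set_val p v).
  move=> p.
  apply: (@continuous_comp _ {ptws V' -> {ptws W -> R}} {ptws W -> R} set_val
    (fun q => q v) p).
    exact: initial_continuous.
  exact: (@proj_continuous V' (fun _ => {ptws W -> R}) v).
have chom : continuous (fun p : Hom K' L => set_val p \o f : {ptws V -> _}).
  move=> p; apply/cvg_sup; first exact/fmap_filter/(nbhs_filter p).
  move=> v; move: p.
  apply/(@continuousP _ (initial_topology (@^~ v))) => _ [C oC <-].
  by apply: open_comp oC => p _; exact: cval.
by move/continuousP: chom => /(_ _ oB).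
Qed.

End HomMap.
End HomComplex.

Arguments Hom R {V W} K L.
Arguments Hom_map R {V V' W K K'} L f.

Section Embedding.
Variables (V : finType) (K : complex V) (s : {set V}) (sK : s \in K).

Fact val_simplex (t : {set {v | v \in s}}) :
  t \in face_complex s -> val @: t \in K.
Proof.
rewrite finset.inE => t0; apply: (simplex_face sK).
  by apply/fintype.subsetP => _ /imsetP[v _ ->]; exact: valP.
by rewrite card_imset //; exact: val_inj.
Qed.

Fact val_simplex_inj (t : {set {v | v \in s}}) :
  t \in face_complex s -> {in t &, injective (val : {v | v \in s} -> V)}.
Proof. by move=> _ ? ? _ _; exact: val_inj. Qed.

Definition embedding : nondeg_map (face_complex s) K :=
  NondegMap val_simplex val_simplex_inj.

End Embedding.

(* For k = 0 the common (k-1)-dimensional face is the empty one. *)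
Definition adjacent (V : finType) (k : nat) (s1 s2 : {set V}) : Prop :=
  [/\ #|s1| = k.+1, #|s2| = k.+1 &
      exists t : {set V}, [/\ t \subset s1, t \subset s2 & #|t| = k]].

Section Perspectivity.
Variables (V : finType) (k : nat) (s1 s2 : {set V}).
Hypotheses (neq12 : s1 != s2) (adj12 : adjacent k s1 s2).

Fact remaining_subproof : exists v, v \in s2 :\: s1.
Proof.
case: adj12 => c1 c2 _; apply/finset.set0Pn; rewrite finset.setD_eq0.
apply: contra neq12 => s21; rewrite eq_sym.
by rewrite finset.eqEcard s21 c1 c2 /=.
Qed.

Fact remaining_in : xchoose remaining_subproof \in s2.
Proof. by have := xchooseP remaining_subproof; rewrite finset.inE => /andP[]. Qed.

Definition remaining : {v | v \in s2} := SigSub remaining_in.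

Fact remaining_notin : val remaining \notin s1.
Proof. by have := xchooseP remaining_subproof; rewrite finset.inE => /andP[]. Qed.

(* insubd sends v to v itself if v \in s2, and to the default otherwise. *)
Definition perspectivity_fun (v : {v | v \in s1}) : {v | v \in s2} :=
  insubd remaining (val v).

Lemma perspectivity_common v :
  val v \in s2 -> val (perspectivity_fun v) = val v.
Proof. by move=> vs2; rewrite /perspectivity_fun val_insubd vs2. Qed.

Lemma perspectivity_remaining v :
  val v \notin s2 -> val (perspectivity_fun v) \notin s1.
Proof.
move=> vs2; rewrite /perspectivity_fun val_insubd (negbTE vs2).
exact: remaining_notin.
Qed.

Lemma perspectivity_inj : injective perspectivity_fun.
Proof.
case: adj12 => c1 c2 [t [t1 t2 ct]].
have cD : (#|s1 :\: s2| <= 1)%N.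
  rewrite cardsD c1 leq_subLR addn1 ltnS -ct subset_leq_card //.
  by rewrite finset.subsetI t1 t2.
move=> u v /(congr1 val); have [us|us] := boolP (val u \in s2);
  have [vs|vs] := boolP (val v \in s2).
- by rewrite !perspectivity_common //; exact: val_inj.
- rewrite perspectivity_common // => uE.
  by have := perspectivity_remaining vs; rewrite -uE (valP u).
- rewrite [RHS]perspectivity_common // => vE.
  by have := perspectivity_remaining us; rewrite vE (valP v).
- move=> _; apply/val_inj; move/card_le1_eqP: cD; apply.
    by rewrite finset.inE vs; exact: valP.
  by rewrite finset.inE us; exact: valP.
Qed.

Fact perspectivity_simplex (t : {set {v | v \in s1}}) :
  t \in face_complex s1 -> perspectivity_fun @: t \in face_complex s2.
Proof. by rewrite !finset.inE card_imset //; exact: perspectivity_inj. Qed.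

Fact perspectivity_simplex_inj (t : {set {v | v \in s1}}) :
  t \in face_complex s1 -> {in t &, injective perspectivity_fun}.
Proof. by move=> _ ? ? _ _; exact: perspectivity_inj. Qed.

Definition perspectivity : nondeg_map (face_complex s1) (face_complex s2) :=
  NondegMap perspectivity_simplex perspectivity_simplex_inj.

Lemma perspectivity_bij : bijective perspectivity.
Proof.
apply: inj_card_bij; first exact: perspectivity_inj.
by case: adj12 => c1 c2 _; rewrite !card_sig c1 c2.
Qed.

(* The map induced by the perspectivity goes from Hom(s2, L) to Hom(s1, L). *)
Definition parallel_transport (R : realType) (W : finType) (L : complex W) :
    Hom R (face_complex s2) L -> Hom R (face_complex s1) L :=
  Hom_map R L perspectivity.

End Perspectivity.

Arguments parallel_transport {V k s1 s2} neq12 adj12 R {W} L.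

Definition homotopic (R : realType) (X Y : topologicalType) (f g : X -> Y) :
    Prop :=
  exists H : X * `[0%R, 1%R : R]%classic -> Y,
    [/\ continuous H,
      forall x (t : `[0%R, 1%R : R]%classic), set_val t = 0 -> H (x, t) = f x &
      forall x (t : `[0%R, 1%R : R]%classic), set_val t = 1 -> H (x, t) = g x].

(* Main.v *)
(** The two maps differ only in the coordinate of the vertex [v0] of [s1] opposite
    to the common face, where they read off [p v0] and [p v1], with [v1] the vertex
    of [s2] opposite to that face. For [p] in the cell of [eta], enlarging
    [eta v0] to [eta v0 :|: eta v1] still gives a cell of [Hom(s1, L)]: a choice of
    one vertex per set uses either [eta v0] or [eta v1], hence is a choice for
    [eta] over [s1] or over [s2]. This cell contains both image points, so the
    straight-line homotopy between them stays in [Hom(s1, L)]. *)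
Require Import Defs.
From mathcomp Require Import all_boot all_order all_algebra.
From mathcomp Require Import all_classical reals topology normedtype.
From mathcomp Require Import ring.

Set Implicit Arguments.
Unset Strict Implicit.
Unset Printing Implicit Defensive.

Import Order.TTheory GRing.Theory Num.Theory.
Import numFieldNormedType.Exports.

Local Open Scope classical_set_scope.
Local Open Scope ring_scope.

(** Of two distinct vertices at least one differs from [v0]. There [eta1] and [eta2] agree, so the
    intersection of the unions splits into one for [eta1] and one for [eta2], both empty along an
    edge. *)
Lemma multihom_setU (V W : finType) (K : complex V) (L : complex W)
    (v0 : V) (eta1 eta2 : V -> {set W}) :
  multihom K L eta1 -> multihom K L eta2 ->
  (forall v, v != v0 -> eta1 v = eta2 v) ->
  multihom K L (fun v => eta1 v :|: eta2 v)%SET.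
Proof.
move=> [ne1 dis1 ch1] [_ dis2 ch2] eq12; split=> [v | u v uv uvK | s sK c cs].
- by apply: (leq_trans (ne1 v)); rewrite subset_leq_card // finset.subsetUl.
- have [uv0|uv0] := eqVneq u v0.
    have vv0 : v != v0 by rewrite -uv0 eq_sym.
    rewrite (eq12 v vv0) finset.setUid finset.setIUl dis2 // finset.setU0.
    by rewrite -(eq12 v vv0) dis1.
  rewrite (eq12 u uv0) finset.setUid finset.setIUr dis2 // finset.setU0.
  by rewrite -(eq12 u uv0) dis1.
(* The test makes sense even if [v0] is not in [s]: then [c v0] is unconstrained, and [c] is a
   choice for both maps on [s]. *)
- have [c0|c0] := boolP (c v0 \in eta1 v0).
    apply: ch1 => // v vs; have [->//|vv0] := eqVneq v v0.
    by have := cs v vs; rewrite -(eq12 v vv0) finset.setUid.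
  apply: ch2 => // v vs; have := cs v vs.
  have [->|vv0] := eqVneq v v0; first by rewrite finset.inE (negbTE c0).
  by rewrite (eq12 v vv0) finset.setUid.
Qed.

Section StraightLine.
Variables (R : realType) (V W : finType).

Definition segment (p q : {ptws V -> {ptws W -> R}}) (t : R) :
    {ptws V -> {ptws W -> R}} :=
  fun v w => (1 - t) * p v w + t * q v w.

Lemma cell_segment (eta : V -> {set W}) p q t :
  0 <= t <= 1 -> cell eta p -> cell eta q -> cell eta (segment p q t).
Proof.
move=> /andP[t0 t1] ep eq v; case: (ep v) (eq v) => p0 p1 pz [q0 q1 qz].
split=> [w||w wv].
- by rewrite addr_ge0 // mulr_ge0 // subr_ge0.
- by rewrite big_split /= -!mulr_sumr p1 q1; ring.
- by rewrite /segment pz // qz // !mulr0 addr0.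
Qed.

Variables (K : complex V) (L : complex W).

Lemma Hom_coord_continuous v w :
  continuous (fun p : Defs.Hom R K L => (set_val p : {ptws V -> {ptws W -> R}}) v w).
Proof.
move=> p.
apply: (@continuous_comp _ {ptws W -> R} R
  (fun p : Defs.Hom R K L => set_val p v) (fun q => q w)).
  apply: (@continuous_comp _ {ptws V -> {ptws W -> R}} {ptws W -> R} set_val
    (fun q => q v)); first exact: initial_continuous.
  exact: (@proj_continuous V (fun _ => {ptws W -> R})).
exact: (@proj_continuous W (fun _ => R)).
Qed.

(** The subspace topology and both pointwise topologies are initial, so continuity is tested after
    composing with the inclusion and then with the evaluations at [v] and [w]. *)
Lemma continuous_coord_Hom (X : topologicalType) (h : X -> Defs.Hom R K L) :
  (forall v w, continuous
    (fun x => (set_val (h x) : {ptws V -> {ptws W -> R}}) v w)) ->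
  continuous h.
Proof.
move=> hc; apply/continuousP => _ [B oB <-].
have hW v : continuous (fun x => set_val (h x) v : {ptws W -> R}).
  move=> x; apply/cvg_sup => w; move: x.
  apply/(@continuousP _ (initial_topology (@^~ w))) => _ [C oC <-].
  by apply: open_comp oC => x _; exact: hc.
have hV : continuous (fun x => set_val (h x) : {ptws V -> {ptws W -> R}}).
  move=> x; apply/cvg_sup => v; move: x.
  apply/(@continuousP _ (initial_topology (@^~ v))) => _ [C oC <-].
  by apply: open_comp oC => x _; exact: hW.
by move/continuousP: hV => /(_ _ oB).
Qed.

(** Cells are convex, so the segment from [f x] to [g x] stays in the complex. The cell may vary
    with [x] without any continuity: the formula for the segment does not involve it, so nothing has
    to be glued. *)
Lemma homotopic_common_cell (X : topologicalType) (f g : X -> Defs.Hom R K L) :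
  continuous f -> continuous g ->
  (forall x, exists eta, [/\ multihom K L eta, cell eta (set_val (f x)) &
                             cell eta (set_val (g x))]) ->
  homotopic R f g.
Proof.
move=> fc gc fg.
have segHom (xt : X * `[0%R, 1%R : R]%classic) :
    Defs.Hom R K L (segment (set_val (f xt.1)) (set_val (g xt.1)) (set_val xt.2)).
  have [eta [he ef eg]] := fg xt.1; exists eta => //; apply: cell_segment => //.
  by have := set_mem (valP xt.2); rewrite /= in_itv.
exists (fun xt => SigSub (mem_set (segHom xt))); split.
- apply: continuous_coord_Hom => v w /= xt.
  have sc : {for xt, continuous
      (fun yt : X * `[0%R, 1%R : R]%classic => set_val yt.2 : R)}.
    apply: (@continuous_comp _ `[0%R, 1%R : R]%classic R snd set_val).
      exact: cvg_snd.
    exact: initial_continuous.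
  have coordc (h : X -> Defs.Hom R K L) : continuous h -> {for xt, continuous
      (fun yt : X * `[0%R, 1%R : R]%classic =>
         (set_val (h yt.1) : {ptws V -> {ptws W -> R}}) v w)}.
    move=> hc.
    apply: (@continuous_comp _ X R fst (fun x =>
      (set_val (h x) : {ptws V -> {ptws W -> R}}) v w)); first exact: cvg_fst.
    apply: (@continuous_comp X (Defs.Hom R K L) R h (fun p =>
      (set_val p : {ptws V -> {ptws W -> R}}) v w)); first exact: hc.
    exact: Hom_coord_continuous.
  (* Each coordinate is a polynomial in [t] and the coordinates of [f x] and [g x]. *)
  apply: cvgD; apply: cvgM; [|exact: coordc|exact: sc|exact: coordc].
  by apply: cvgB; [exact: cvg_cst|exact: sc].
- move=> x t t0; apply: val_inj; apply/funext => v; apply/funext => w /=.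
  by rewrite /segment /= t0 subr0 mul1r mul0r addr0.
- move=> x t t1; apply: val_inj; apply/funext => v; apply/funext => w /=.
  by rewrite /segment /= t1 subrr mul0r mul1r add0r.
Qed.

End StraightLine.

Lemma adjacent_opposite_vertex (V : finType) (k : nat) (s1 s2 : {set V}) :
  s1 != s2 -> adjacent k s1 s2 ->
  exists v0 : {v | v \in s1}, forall v, v != v0 -> val v \in s2.
Proof.
move=> neq [c1 c2 [t [t1 t2 ct]]].
(* The common face [t] lies in the intersection, which therefore has at least [k] of the [k.+1]
   vertices of [s1]. *)
have cD : (#|s1 :\: s2| <= 1)%N.
  rewrite cardsD c1 leq_subLR addn1 ltnS -ct subset_leq_card //.
  by rewrite finset.subsetI t1 t2.
have [v0 v0D] : exists v, v \in s1 :\: s2.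
  apply/finset.set0Pn; rewrite finset.setD_eq0; apply: contra neq => s12.
  by rewrite finset.eqEcard s12 c1 c2 /=.
have v0s1 : v0 \in s1 by move: v0D; rewrite finset.inE => /andP[].
exists (SigSub v0s1) => v; apply: contraR => vs2; apply/eqP/val_inj.
move/card_le1_eqP: cD; apply => //.
by rewrite finset.inE vs2; exact: valP.
Qed.

Theorem proposition4p16 (R : realType) (V W : finType)
    (K : complex V) (L : complex W) (k : nat) (s1 s2 : {set V})
    (s1K : s1 \in K) (s2K : s2 \in K)
    (neq12 : s1 != s2) (adj12 : adjacent k s1 s2) :
  homotopic R
    (parallel_transport neq12 adj12 R L \o Hom_map R L (embedding s2K))
    (Hom_map R L (embedding s1K)).
Proof.
apply: homotopic_common_cell.
- by move=> p; apply: continuous_comp; exact: Hom_map_continuous.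
- exact: Hom_map_continuous.
move=> p; have [eta he ep] := set_mem (valP p).
have [v0 v0P] := adjacent_opposite_vertex neq12 adj12.
pose eta1 := eta \o embedding s1K.
(* This indexes a cell containing the transported point; at [v0] its value is that of [eta] at the
   remaining vertex of [s2]. *)
pose eta2 := (eta \o embedding s2K) \o perspectivity neq12 adj12.
(* Enlarging the vertex sets only drops vanishing conditions on barycentric coordinates. *)
have sub_cell (e e' : {v | v \in s1} -> {set W})
    (q : {ptws {v | v \in s1} -> {ptws W -> R}}) :
    (forall v, e v \subset e' v) -> cell e q -> cell e' q.
  move=> ee' eq v; case: (eq v) => q0 q1 qz; split=> // w we'; apply: qz.
  by apply: contra we'; apply/fintype.subsetP.
exists (fun v => eta1 v :|: eta2 v)%SET; split.
- apply: (@multihom_setU _ _ _ _ v0).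
  + exact: multihom_comp.
  + by do 2 apply: multihom_comp.
  + by move=> v /v0P vs2; rewrite /eta1 /eta2 /= perspectivity_common.
- apply: (@sub_cell eta2) => [v|]; first exact: finset.subsetUr.
  by do 2 apply: cell_comp.
- apply: (@sub_cell eta1) => [v|]; first exact: finset.subsetUl.
  exact: cell_comp.
Qed.
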